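(* Let $S\subset\mathbb{R}^q$ be compact and $\ell:\mathbb{R}^q\times\mathbb{R}^q\to(0,1)$ continuous. Let $s\in S$ and let $(\xi_k)_{k\in\mathbb{N}}\subset\mathbb{R}^q$ be a bounded sequence. Let $d_1,d_2,\dots\in\{0,1\}$ be independent random variables with $\Pr(d_k=1)=\ell(s,\xi_k)$. Let $c_1,\dots,c_M\in S$ be distinct, let $\hat p_0:\{1,\dots,M\}\to(0,1)$ with $\sum_i\hat p_0(i)=1$, and define $\hat p_k$ by the recursion $$\hat p_k(i\mid d_{1:k};\xi_{1:k})=\frac{g(d_k\mid c_i;\xi_k)\,\hat p_{k-1}(i\mid d_{1:k-1};\xi_{1:k-1})}{\sum_{j=1}^M g(d_k\mid c_j;\xi_k)\,\hat p_{k-1}(j\mid d_{1:k-1};\xi_{1:k-1})},$$ where $g(d\mid x;\xi)=\ell(x,\xi)^d(1-\ell(x,\xi))^{1-d}$. For $i,j\in\{1,\dots,M\}$ define $$\mu^{(i,j)}_k=\ell(s,\xi_k)\ln\frac{\ell(c_i,\xi_k)}{\ell(c_j,\xi_k)}+(1-\ell(s,\xi_k))\ln\frac{1-\ell(c_i,\xi_k)}{1-\ell(c_j,\xi_k)}.$$ If there exist a pair $(i,j)$ and some $p>\tfrac12$ such that $$\limsup_{n\to\infty}\frac{1}{n^p}\sum_{k=1}^n\mu^{(i,j)}_k<0,$$ then $\hat p_k(i\mid d_{1:k};\xi_{1:k})\to 0$ almost surely as $k\to\infty$.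
   Context: $\mu^{(i,j)}_k$ is the expected value, under the true source location $s$, of the log-likelihood ratio $\ln[g(d_k\mid c_i;\xi_k)/g(d_k\mid c_j;\xi_k)]$. *)

(* Defs.v *)
From HB Require Import structures.
From mathcomp Require Import all_boot all_order all_algebra.
From mathcomp Require Import finmap.
From mathcomp Require Import all_classical all_reals all_analysis.
Set Implicit Arguments. Unset Strict Implicit. Unset Printing Implicit Defensive.
Import Order.TTheory GRing.Theory Num.Theory.
Import numFieldNormedType.Exports.
Local Open Scope classical_set_scope.
Local Open Scope ring_scope.

Definition mutually_independent_RVs {d : measure_display} {T : measurableType d}
  {R : realType} (P : probability T R) (I : set nat) (X : nat -> T -> R) : Prop :=
  forall (F : {fset nat}) (B : nat -> set R),
    (forall k, k \in F -> I k) ->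
    (forall k, k \in F -> measurable (B k)) ->
    P (\bigcap_(k in [set k | k \in F]) (X k @^-1` B k)) =
    (\prod_(k <- F) P (X k @^-1` B k))%E.

Definition gobs {R : realType} {q : nat} (ell : 'rV[R]_q -> 'rV[R]_q -> R)
  (d : R) (x xi : 'rV[R]_q) : R :=
  (ell x xi) `^ d * (1 - ell x xi) `^ (1 - d).

(* Recursive posterior: phat k i = phat_k(i | d_{1:k}; xi_{1:k}); the data
   are indexed from 1 (dd k = d_k, xi k = xi_k for k >= 1). *)
Fixpoint phat {R : realType} {q M : nat} (ell : 'rV[R]_q -> 'rV[R]_q -> R)
  (c : 'I_M -> 'rV[R]_q) (p0 : 'I_M -> R) (xi : nat -> 'rV[R]_q)
  (dd : nat -> R) (k : nat) (i : 'I_M) : R :=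
  match k with
  | 0 => p0 i
  | k'.+1 =>
      gobs ell (dd k) (c i) (xi k) * phat ell c p0 xi dd k' i /
      \sum_(j < M) gobs ell (dd k) (c j) (xi k) * phat ell c p0 xi dd k' j
  end.

Definition mu {R : realType} {q M : nat} (ell : 'rV[R]_q -> 'rV[R]_q -> R)
  (s : 'rV[R]_q) (c : 'I_M -> 'rV[R]_q) (xi : nat -> 'rV[R]_q)
  (i j : 'I_M) (k : nat) : R :=
  ell s (xi k) * ln (ell (c i) (xi k) / ell (c j) (xi k)) +
  (1 - ell s (xi k)) * ln ((1 - ell (c i) (xi k)) / (1 - ell (c j) (xi k))).

(* Main.v *)
Require Import Defs.
From HB Require Import structures.
From mathcomp Require Import all_boot all_order all_algebra.
From mathcomp Require Import finmap.
From mathcomp Require Import all_classical all_reals all_analysis.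
From mathcomp Require Import ring lra.
Import Order.TTheory GRing.Theory Num.Theory.
Import numFieldNormedType.Exports.
Local Open Scope classical_set_scope.
Local Open Scope ring_scope.

(* With Y_k := ln (g(d_k|c_i) / g(d_k|c_j)), the posterior at i is at most
   (p0 i / p0 j) * exp (Y_1 + ... + Y_n), so it suffices that the sum tends to -oo almost
   surely. The Y_k are independent with mean mu_k, and bounded since ell(c_i, .) and
   ell(c_j, .) stay away from 0 and 1 on a bounded set. By Chernoff with parameter of order
   n^(-1/2), the centred sum exceeds (e / 2) n^p with probability at most
   exp (1 - K n^(p - 1/2)). This is summable because p > 1/2, so Borel-Cantelli and
   mu_1 + ... + mu_n <= - e n^p give Y_1 + ... + Y_n < - (e / 2) n^p eventually. *)

(** * Chernoff bound for sums of independent Bernoulli variables *)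

(** Squaring [1 - x / 2 <= expR (- (x / 2))] gives [expR x * (1 - x / 2) ^+ 2 <= 1], which reduces
    the claim to a polynomial inequality. *)
Lemma expR_le1DxDx2 (R : realType) (x : R) :
  `|x| <= 1 / 3 -> expR x <= 1 + x + x ^+ 2.
Proof.
rewrite ler_norml => /andP[x1 x2].
have h : 1 - x / 2 <= expR (- (x / 2)) by exact: expR_ge1Dx.
have h0 : 0 < 1 - x / 2 by lra.
have e1 : expR x * expR (- (x / 2)) ^+ 2 = 1.
  by rewrite -expRM_natl -expRD -[RHS]expR0; congr expR; field.
have le1 : expR x * (1 - x / 2) ^+ 2 <= 1.
  by rewrite -[leRHS]e1 ler_pM2l ?expR_gt0// !expr2 ler_pM// ltW.
have le2 : 1 <= (1 + x + x ^+ 2) * (1 - x / 2) ^+ 2.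
  (* The two sides of [le2] differ by a quarter of this product, whose second factor is nonnegative
     because [x <= 1 / 3]. *)
  have : 0 <= x ^+ 2 * (1 - 3 * x + x ^+ 2) by nra.
  nra.
by have := le_trans le1 le2; rewrite ler_pM2r ?exprn_gt0.
Qed.

(** Centring cancels the linear terms of the quadratic bounds on the two exponentials; what remains
    is [1 + l * (1 - l) * h ^+ 2], at most [1 + h ^+ 2]. *)
Lemma bernoulli_mgf_le (R : realType) (l h : R) : 0 <= l <= 1 -> `|h| <= 1 / 3 ->
  l * expR ((1 - l) * h) + (1 - l) * expR (- l * h) <= expR (h ^+ 2).
Proof.
move=> /andP[l0 l1] hh.
have e1 : expR ((1 - l) * h) <= 1 + (1 - l) * h + ((1 - l) * h) ^+ 2.
  apply: expR_le1DxDx2; rewrite normrM ger0_norm; last lra.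
  by apply: (le_trans _ hh); rewrite ler_piMl//; lra.
have e2 : expR (- l * h) <= 1 + (- l * h) + (- l * h) ^+ 2.
  apply: expR_le1DxDx2; rewrite normrM normrN (ger0_norm l0).
  by apply: (le_trans _ hh); rewrite ler_piMl.
apply: le_trans _ (expR_ge1Dx _).
have {}e1 := ler_wpM2l l0 e1.
have l1' : 0 <= 1 - l by lra.
have {}e2 := ler_wpM2l l1' e2.
apply: le_trans (lerD e1 e2) _.
rewrite -subr_ge0.
rewrite (_ : _ - _ = h ^+ 2 * (1 - l * (1 - l))); last by ring.
by apply: mulr_ge0; [exact: sqr_ge0|nra].
Qed.

Lemma measurable_affine_sum_ge (R : realType) (d : measure_display)
    (T : measurableType d) (P : probability T R) (X : nat -> {RV P >-> R})
    (a b : nat -> R) (n : nat) (t : R) :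
  measurable [set w | t <= \sum_(1 <= k < n.+1) (b k + a k * X k w)].
Proof.
have mS : measurable_fun setT (fun w => \sum_(1 <= k < n.+1) (b k + a k * X k w)).
  apply: measurable_sum => k; apply: measurable_realfun.measurable_funD => //.
  by apply: measurable_realfun.measurable_funM => //; exact: measurable_funP.
rewrite (_ : [set w | _] = setT `&`
  (fun w => \sum_(1 <= k < n.+1) (b k + a k * X k w)) @^-1` `[t, +oo[); first exact: mS.
by rewrite setTI; apply/seteqP; split => w /=; rewrite in_itv/= andbT.
Qed.

(* The factor [P (\bigcap ...)], an event about indices beyond [n], is carried along so
   that conditioning on [X n.+1] in the induction stays within the statement. *)
Lemma bernoulli_sum_tail_cap (R : realType) (d : measure_display)
    (T : measurableType d) (P : probability T R) (X : nat -> {RV P >-> R})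
    (l a b : nat -> R) (n : nat) (F : {fset nat}) (B : nat -> set R) (t : R) :
  (forall k, (0 < k)%N -> forall w, X k w = 0 \/ X k w = 1) ->
  (forall k, (0 < k)%N -> P (X k @^-1` [set 1]) = (l k)%:E) ->
  mutually_independent_RVs P [set k | (0 < k)%N] (fun k => X k : T -> R) ->
  (forall k, k \in F -> (n < k)%N) -> (forall k, measurable (B k)) ->
  (P ([set w | (t <= \sum_(1 <= k < n.+1) (b k + (a k - b k) * X k w))%R]
      `&` \bigcap_(k in [set k | k \in F]) X k @^-1` B k) <=
   (expR (- t) * \prod_(1 <= k < n.+1) (l k * expR (a k) + (1 - l k) * expR (b k)))%:E
   * P (\bigcap_(k in [set k | k \in F]) X k @^-1` B k))%E.
Proof.
move=> X01 PX iX.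
have mX k (C : set R) : measurable C -> measurable (X k @^-1` C).
  by move=> mC; rewrite -[X in measurable X]setTI; exact: measurable_funP.
elim: n F B t => [|n IH] F B t Fn mB;
  have mE : measurable (\bigcap_(k in [set k | k \in F]) X k @^-1` B k)
    by apply: bigcap_measurableType => // k _; exact: mX.
  rewrite big_nil mulr1.
  (* The sum is empty: for [t > 0] the event is empty, and for [t <= 0] the factor [expR (- t)] is
     at least 1. *)
  have [t0|t0] := leP t 0; last first.
    rewrite (_ : _ `&` _ = set0) ?measure0.
      by apply: mule_ge0 => //; rewrite lee_fin expR_ge0.
    by rewrite -subset0 => w /= []; rewrite big_nil leNgt t0.
  rewrite (_ : _ `&` _ = \bigcap_(k in [set k | k \in F]) X k @^-1` B k); last first.
    by apply/seteqP; split => [w []//|w Ew]; split => //=; rewrite big_nil.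
  rewrite -[leLHS]mul1e; apply: lee_wpmul2r => //.
  by rewrite lee_fin -[leLHS]expR0 ler_expR; lra.
set E := \bigcap_(k in [set k | k \in F]) X k @^-1` B k.
(* Forcing [X n.+1] to equal [v] gives again an event about indices beyond [n], to which [IH]
   applies. *)
pose B' (v : R) k := if k == n.+1 then [set v] else B k.
have mB' v k : measurable (B' v k) by rewrite /B'; case: ifP.
have n1F : n.+1 \notin F by apply/negP => /Fn; rewrite ltnn.
pose F' := (n.+1 |` F)%fset.
have F'n k : k \in F' -> (n < k)%N.
  by rewrite in_fset1U => /orP[/eqP->//|/Fn /ltnW].
have E'E v : \bigcap_(k in [set k | k \in F']) X k @^-1` B' v k =
    X n.+1 @^-1` [set v] `&` E.
  apply/seteqP; split => w /=.
    move=> Ew; split; first by have := Ew n.+1; rewrite /= /F' fset1U1 /B' eqxx; exact.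
    move=> k /= kF; have := Ew k; rewrite /= /F' in_fset1U kF orbT /B'.
    by case: eqP kF n1F => [->->//|_ _ _]; exact.
  move=> [Xw Ew] k /=; rewrite /F' in_fset1U /B'; case: eqP => [->//|_ /=].
  exact: Ew.
(* Independence is used twice, for [F'] and for [F], to split off the factor of [X n.+1]. *)
have PE' v : P (X n.+1 @^-1` [set v] `&` E) = (P (X n.+1 @^-1` [set v]) * P E)%E.
  rewrite -E'E iX//; last by move=> k /F'n/=; exact: leq_ltn_trans.
  rewrite big_fsetU1//= /B' eqxx; congr (_ * _)%E.
  rewrite /E iX//; last by move=> k /Fn/=; exact: leq_ltn_trans.
  rewrite !big_seq; apply: eq_bigr => k kF.
  by case: eqP kF n1F => [->->|].
have P0 : P (X n.+1 @^-1` [set 0]) = (1 - l n.+1)%:E.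
  rewrite (_ : X n.+1 @^-1` [set 0] = ~` (X n.+1 @^-1` [set 1])).
    by rewrite probability_setC ?PX//; exact: mX.
  apply/seteqP; split => w /=; first by move=> -> /esym/eqP; rewrite oner_eq0.
  by have [] := X01 n.+1 isT w.
set Pi := fun m => \prod_(1 <= k < m.+1) (l k * expR (a k) + (1 - l k) * expR (b k)).
pose A t' := [set w | (t' <= \sum_(1 <= k < n.+1) (b k + (a k - b k) * X k w))%R].
(* The last summand is [a n.+1] or [b n.+1] according to the value of [X n.+1]; it is moved into the
   threshold. *)
have -> : [set w | (t <= \sum_(1 <= k < n.+2) (b k + (a k - b k) * X k w))%R] `&` E =
    (A (t - a n.+1) `&` (X n.+1 @^-1` [set 1] `&` E)) `|`
    (A (t - b n.+1) `&` (X n.+1 @^-1` [set 0] `&` E)).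
  apply/seteqP; split => w /=; rewrite big_nat_recr//= /A /=.
    move=> [tw Ew]; have [Xw|Xw] := X01 n.+1 isT w; [right|left]; split => //;
    by rewrite lerBlDr (le_trans tw)// Xw; lra.
  by move=> [|] [tw [Xw Ew]]; split => //; move: tw; rewrite Xw; lra.
apply: le_trans; first apply: measureU2.
- by apply: measurableI; [exact: measurable_affine_sum_ge|apply: measurableI => //; exact: mX].
- by apply: measurableI; [exact: measurable_affine_sum_ge|apply: measurableI => //; exact: mX].
rewrite -!E'E.
apply: le_trans (leeD (IH _ _ _ F'n (mB' 1)) (IH _ _ _ F'n (mB' 0))) _.
rewrite !E'E !PE' P0 PX// -/(Pi n) -/(Pi n.+1).
have l01 k : (0 < k)%N -> 0 <= l k <= 1.
  by move=> k0; rewrite -2!lee_fin -PX// measure_ge0 probability_le1//; exact: mX.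
have Pi0 : 0 <= Pi n.
  rewrite /Pi big_seq; apply: prodr_ge0 => k.
  rewrite mem_index_iota => /andP[/l01/andP[? ?] _].
  by rewrite addr_ge0// mulr_ge0 ?expR_ge0// subr_ge0.
have /andP[l0 l1] := l01 n.+1 isT.
rewrite !muleA -ge0_muleDl//; last 2 first.
- by rewrite -EFinM lee_fin !mulr_ge0 ?expR_ge0.
- by rewrite -EFinM lee_fin !mulr_ge0 ?expR_ge0 ?subr_ge0.
rewrite -!EFinM -EFinD.
apply: lee_wpmul2r => //; rewrite lee_fin /Pi (big_nat_recr n.+1)//= -/(Pi n).
rewrite !opprB !expRD.
by rewrite le_eqVlt; apply/orP; left; apply/eqP; ring.
Qed.

(** With a parameter of order [1 / (D * sqrt n)], each of the [n] moment generating factors is at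
    most [expR (1 / n)]; their product accounts for the [1] in the exponent. *)
Lemma bernoulli_sum_deviation (R : realType) (d : measure_display)
    (T : measurableType d) (P : probability T R) (X : nat -> {RV P >-> R})
    (l a b : nat -> R) (D t : R) (n : nat) :
  (forall k, (0 < k)%N -> forall w, X k w = 0 \/ X k w = 1) ->
  (forall k, (0 < k)%N -> P (X k @^-1` [set 1]) = (l k)%:E) ->
  mutually_independent_RVs P [set k | (0 < k)%N] (fun k => X k : T -> R) ->
  0 < D -> (forall k, (0 < k)%N -> `|a k - b k| <= D) -> (0 < n)%N ->
  (P [set w | (t <= \sum_(1 <= k < n.+1)
        (b k + (a k - b k) * X k w - (l k * a k + (1 - l k) * b k)))%R] <=
   (expR (1 - t / (3 * D * Num.sqrt n%:R)))%:E)%E.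
Proof.
move=> X01 PX iX D0 abD n0.
have l01 k : (0 < k)%N -> 0 <= l k <= 1.
  by move=> k0; rewrite -2!lee_fin -PX// measure_ge0 probability_le1.
have n0' : 1 <= n%:R :> R by rewrite ler1n.
have s1 : 1 <= Num.sqrt n%:R :> R by rewrite -[leLHS]sqrtr1 ler_sqrt// ltW// ltr0n.
have s0 : 0 < Num.sqrt n%:R :> R by exact: lt_le_trans s1.
(* The factor 3 meets the condition [|h| <= 1 / 3] of [bernoulli_mgf_le]; the square root makes
   [h ^+ 2] at most [1 / n]. *)
pose r : R := (3 * D * Num.sqrt n%:R)^-1.
have r0 : 0 < r by rewrite invr_gt0 !mulr_gt0.
have hr k : (0 < k)%N -> `|r * (a k - b k)| <= (3 * Num.sqrt n%:R)^-1.
  move=> k0; rewrite normrM gtr0_norm// /r.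
  rewrite (_ : (3 * Num.sqrt n%:R)^-1 = (3 * D * Num.sqrt n%:R)^-1 * D); last first.
    by field; rewrite !gt_eqF.
  by rewrite ler_wpM2l ?abD// ltW.
(* [a' k] and [b' k] are the values of the centred summand, scaled by [r], when [X k] is 1 and 0. *)
pose a' k := (1 - l k) * (r * (a k - b k)).
pose b' k := - l k * (r * (a k - b k)).
have := @bernoulli_sum_tail_cap R d T P X l a' b' n fset0 (fun=> setT) (r * t) X01 PX iX.
rewrite (_ : \bigcap_(k in _) _ = setT); last by apply/seteqP; split => // w _ k.
move=> /(_ _ _)/wrap[]//; rewrite setIT probability_setT mule1.
rewrite [X in (P X <= _)%E -> _](_ : _ = [set w | (t <= \sum_(1 <= k < n.+1)
        (b k + (a k - b k) * X k w - (l k * a k + (1 - l k) * b k)))%R]); last first.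
  have SE w : \sum_(1 <= k < n.+1) (b' k + (a' k - b' k) * X k w) =
      r * \sum_(1 <= k < n.+1)
        (b k + (a k - b k) * X k w - (l k * a k + (1 - l k) * b k)).
    by rewrite mulr_sumr; apply: eq_bigr => k _; rewrite /a' /b'; ring.
  by apply/seteqP; split => w /=; rewrite SE ler_pM2l.
move=> /le_trans; apply; rewrite lee_fin addrC expRD (mulrC t) ler_pM2l ?expR_gt0//.
rewrite (@le_trans _ _ (\prod_(1 <= k < n.+1) expR n%:R^-1))//; last first.
  rewrite prodr_const_nat subSS subn0 -expRM_natl mulfV// pnatr_eq0 -lt0n//.
rewrite big_seq [leRHS]big_seq; apply: ler_prod => k.
rewrite mem_index_iota => /andP[k0 _]; have /andP[? ?] := l01 k k0.
rewrite addr_ge0 ?mulr_ge0 ?expR_ge0 ?subr_ge0//=.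
apply: le_trans (bernoulli_mgf_le _ _ _ _ _) _; rewrite ?l01//.
  apply: le_trans (hr k k0) _.
  by rewrite div1r lef_pV2 ?posrE ?mulr_gt0// ler_peMr.
rewrite ler_expR -real_normK ?num_real//.
apply: (@le_trans _ _ ((3 * Num.sqrt n%:R)^-1 ^+ 2)).
  by rewrite lerXn2r ?nnegrE ?hr// invr_ge0 mulr_ge0// ltW.
rewrite exprVn exprMn sqr_sqrtr; last by rewrite ltW// ltr0n.
by rewrite lef_pV2 ?posrE ?mulr_gt0 ?exprn_gt0 ?ltr0n// ler_peMl//; lra.
Qed.

(** * Summability, Borel-Cantelli, and constants extracted from limits and compactness *)

(** A single term [x ^+ m / m!] of the exponential series already gives decay of order [n ^- 2], and
    [1 / n ^+ 2 <= 2 / (n * (n + 1))], which telescopes. *)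
Lemma expR_stretched_le (R : realType) (c a : R) : 0 < c -> 0 < a ->
  exists2 C : R, 0 < C & forall n : nat, (0 < n)%N ->
    expR (- (c * n%:R `^ a)) <= C * (n%:R^-1 - n.+1%:R^-1).
Proof.
move=> c0 a0.
(* The power [k.+1] exceeds [2 / a], so that [n ^ (a * k.+1)] dominates [n ^ 2]. *)
pose k := Num.truncn (2 / a).
have ak : 2 <= a * k.+1%:R by rewrite mulrC -ler_pdivrMr// ltW// truncnS_gt.
have kf0 : 0 < k.+1`!%:R :> R by rewrite ltr0n fact_gt0.
have ck0 : 0 < c ^+ k.+1 by rewrite exprn_gt0.
exists (2 * k.+1`!%:R / c ^+ k.+1); first by rewrite !mulr_gt0// invr_gt0.
move=> n n0; have n0' : 1 <= n%:R :> R by rewrite ler1n.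
set x := c * n%:R `^ a.
have nn0 : 0 < n%:R :> R by rewrite ltr0n.
have x0 : 0 <= x by rewrite mulr_ge0// ?powR_ge0// ltW.
have h1 : c ^+ k.+1 * n%:R ^+ 2 / k.+1`!%:R <= expR x.
  have := expR_ge1Dxn k x0; apply: le_trans.
  apply: (@le_trans _ _ (x ^+ k.+1 / k.+1`!%:R)); last by rewrite lerDr.
  rewrite ler_pM2r ?invr_gt0// /x exprMn ler_pM2l//.
  rewrite -[leRHS]powR_mulrn ?powR_ge0// -powRrM -powR_mulrn; last exact: ltW.
  exact: ler_powR.
have h2 : 0 < c ^+ k.+1 * n%:R ^+ 2 / k.+1`!%:R.
  by rewrite divr_gt0// mulr_gt0// exprn_gt0.
rewrite expRN (@le_trans _ _ (c ^+ k.+1 * n%:R ^+ 2 / k.+1`!%:R)^-1)//.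
  by rewrite lef_pV2 ?posrE ?expR_gt0.
rewrite -natr1.
rewrite (_ : _^-1 = k.+1`!%:R / c ^+ k.+1 * (n%:R ^+ 2)^-1); last first.
  by field; rewrite !gt_eqF.
rewrite (_ : _ * (_ - _) = k.+1`!%:R / c ^+ k.+1 * (2 / (n%:R * (n%:R + 1)))); last first.
  by field; rewrite !gt_eqF// addr_gt0.
rewrite ler_pM2l ?divr_gt0// -div1r ler_pdivrMr ?exprn_gt0//.
rewrite mulrAC ler_pdivlMr ?mulr_gt0 ?addr_gt0//.
nra.
Qed.

(** The partial sums of the bound collapse to [C * (1 / N - 1 / (N + m))], at most [C / N]. *)
Lemma nneseries_telescope_lty (R : realType) (u : (\bar R)^nat) (C : R) (N : nat) :
  0 < C -> (0 < N)%N -> (forall n, 0 <= u n)%E ->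
  (forall n, u n <= (C * ((N + n)%:R^-1 - (N + n).+1%:R^-1))%:E)%E ->
  (\sum_(n <oo) u n < +oo)%E.
Proof.
move=> C0 N0 u0 uC; apply: (@le_lt_trans _ _ (C * N%:R^-1)%:E); last exact: ltry.
apply: lime_le; first exact: is_cvg_nneseries.
apply: nearW => m.
apply: le_trans; first by apply: lee_sum => n _; exact: uC.
rewrite sumEFin lee_fin -mulr_sumr ler_pM2l//.
have := @telescope_sumr R 0 m (fun n => - (N + n)%:R^-1) (leq0n m).
under eq_bigr do rewrite opprK addrC addnS.
by move=> ->; rewrite opprK addn0 addrC gerBl invr_ge0.
Qed.

(** Borel-Cantelli: the exceptional set is [lim_sup_set F], which is null. *)
Lemma ae_eventually_notin (R : realType) (d : measure_display)
    (T : measurableType d) (P : probability T R) (F : (set T)^nat) :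
  (forall n, measurable (F n)) -> (\sum_(n <oo) P (F n) < +oo)%E ->
  {ae P, forall w, \forall n \near \oo, ~ F n w}.
Proof.
move=> mF sF; exists (lim_sup_set F); split.
- apply: bigcap_measurableType => n _.
  exact: bigcup_measurable.
- exact: lim_sup_set_cvg0.
- move=> w /= nF n _; apply: contrapT => nw; apply: nF.
  by exists n => // m /= nm Fw; apply: nw; exists m.
Qed.

Lemma limn_esup_lt0_near (R : realType) (u : R^nat) :
  (limn_esup (fun n => (u n)%:E) < 0)%E ->
  exists2 e : R, 0 < e & \forall n \near \oo, u n <= - e.
Proof.
rewrite /limn_esup limf_esupE => /ereal_inf_lt[_ [V /= [N _ NV] <-]] sup0.
(* The supremum may be [-oo], in which case [e = 1] serves. *)
have [e e0 se] : exists2 e : R, 0 < e & (ereal_sup ((fun n => (u n)%:E) @` V) <= (- e)%:E)%E.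
  case: ereal_sup sup0 => [r| |]//=.
    by rewrite lte_fin => r0; exists (- r); rewrite ?oppr_gt0// opprK.
  by move=> _; exists 1; rewrite ?leNye.
exists e => //; exists N => // n /NV Vn.
rewrite -lee_fin; apply: le_trans se.
by apply: ereal_sup_ubound; exists n.
Qed.

(** The sequence lies in a closed ball, compact in finite dimension, where [f] attains a positive
    minimum. *)
Lemma bounded_seq_continuous_pos (R : realType) (q : nat)
    (f : 'rV[R]_q -> R) (x : nat -> 'rV[R]_q) :
  continuous f -> (forall y, 0 < f y) -> (exists r : R, forall k, `|x k| <= r) ->
  exists2 e : R, 0 < e & forall k, e <= f (x k).
Proof.
move=> cf f0 [r xr].
pose A := closed_ball_ Num.norm (0 : 'rV[R]_q) r.
have AE y : A y = (`|y| <= r) :> Prop by rewrite /A /closed_ball_/= sub0r normrN.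
have A0 : A !=set0 by exists (x 0%N); rewrite AE.
have cA : compact A.
  apply: bounded_closed_compact; last exact: closed_closed_ball_.
  exists r; split; first exact: num_real.
  by move=> M rM y; rewrite AE => /le_trans; apply; exact: ltW.
have [c _ cmin] := compact_EVT_min A0 cA (continuous_subspaceT cf).
by exists (f c) => // k; apply: cmin; rewrite inE AE.
Qed.

(** * Posterior ratios and log-likelihood increments *)

Lemma gobs_gt0 (R : realType) (q : nat) (ell : 'rV[R]_q -> 'rV[R]_q -> R)
    (v : R) (x y : 'rV[R]_q) :
  0 < ell x y < 1 -> 0 < gobs ell v x y.
Proof. by move=> /andP[? ?]; rewrite mulr_gt0// powR_gt0// subr_gt0. Qed.

Section posterior.
Context (R : realType) (q M : nat) (ell : 'rV[R]_q -> 'rV[R]_q -> R).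
Context (c : 'I_M -> 'rV[R]_q) (p0 : 'I_M -> R) (xi : nat -> 'rV[R]_q) (v : nat -> R).
Hypothesis ell01 : forall x y, 0 < ell x y < 1.
Hypothesis p01 : forall i, 0 < p0 i < 1.

Let g k i := gobs ell (v k) (c i) (xi k).
Let ph := phat ell c p0 xi v.

Let g_gt0 k i : 0 < g k i. Proof. exact: gobs_gt0. Qed.

Lemma phat_gt0 k i : 0 < ph k i.
Proof.
elim: k i => [|k IH] i /=; first by have /andP[] := p01 i.
have gp j : 0 < gobs ell (v k.+1) (c j) (xi k.+1) * phat ell c p0 xi v k j.
  by apply: mulr_gt0; [exact: g_gt0|exact: IH].
rewrite divr_gt0// (bigD1 i)//= ltr_wpDr//.
by apply: sumr_ge0 => j _; exact/ltW/gp.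
Qed.

(** The index argument excludes [M = 0], where the sum is empty. *)
Let norm_gt0 k : 'I_M -> 0 < \sum_(j < M) g k.+1 j * ph k j.
Proof.
have gp j : 0 < g k.+1 j * ph k j by rewrite mulr_gt0 ?phat_gt0.
move=> i; rewrite (bigD1 i)//= ltr_wpDr//.
by apply: sumr_ge0 => j _; exact/ltW/gp.
Qed.

Lemma phat_le1 k i : ph k i <= 1.
Proof.
case: k => [|k] /=; first by have /andP[_ /ltW] := p01 i.
rewrite ler_pdivrMr ?mul1r; last exact: (norm_gt0 k i).
rewrite (bigD1 i)//= lerDl.
by apply: sumr_ge0 => j _; rewrite ltW// mulr_gt0//; [exact: g_gt0|exact: phat_gt0].
Qed.

(** The normalising sum is common to [i] and [j], so it cancels, and each step multiplies the ratio
    of posteriors by the likelihood ratio. *)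
Lemma phat_ratio k i j : ph k i =
  ph k j * (p0 i / p0 j) *
  expR (\sum_(1 <= m < k.+1) (ln (g m i) - ln (g m j))).
Proof.
elim: k => [|k IH].
  rewrite big_nil expR0 mulr1 /= mulrC divfK// gt_eqF//.
  by have /andP[] := p01 j.
have Z0 := norm_gt0 k i; set Z := \sum_(j < M) _ in Z0.
have phS m : ph k.+1 m = g k.+1 m * ph k m / Z by [].
rewrite big_nat_recr//= expRD expRB !lnK ?posrE ?g_gt0// !phS IH.
have gj := g_gt0 k.+1 j; have /andP[pj _] := p01 j.
by field; rewrite !gt_eqF.
Qed.

Lemma phat_le_expR k i j : ph k i <=
  p0 i / p0 j * expR (\sum_(1 <= m < k.+1) (ln (g m i) - ln (g m j))).
Proof.
rewrite (phat_ratio k i j) -mulrA ler_piMl ?phat_le1//.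
have /andP[pi _] := p01 i; have /andP[pj _] := p01 j.
by rewrite mulr_ge0 ?expR_ge0// divr_ge0// ltW.
Qed.

End posterior.

(** On [{0, 1}] the log-likelihood ratio is affine in the datum, the shape [b + (a - b) * X] of the
    tail bound. *)
Lemma ln_gobs_ratio (R : realType) (q : nat) (ell : 'rV[R]_q -> 'rV[R]_q -> R)
    (v : R) (x x' y : 'rV[R]_q) :
  (forall x y, 0 < ell x y < 1) -> v = 0 \/ v = 1 ->
  ln (gobs ell v x y) - ln (gobs ell v x' y) =
  ln ((1 - ell x y) / (1 - ell x' y)) +
  (ln (ell x y / ell x' y) - ln ((1 - ell x y) / (1 - ell x' y))) * v.
Proof.
move=> ell01; have /andP[a0 a1] := ell01 x y; have /andP[b0 b1] := ell01 x' y.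
rewrite !ln_div ?posrE ?subr_gt0// /gobs => -[->|->].
  by rewrite !powRr0 subr0 !powRr1 ?subr_ge0 ?ltW// !mul1r mulr0 addr0.
by rewrite subrr !powRr0 !powRr1 ?ltW// !mulr1; ring.
Qed.

(** A uniform lower bound [e] on a function with values in [(0, 1)] confines its logarithm to
    [[ln e, 0]]. *)
Lemma ln_ratio_bounded (R : realType) (q : nat) (f g : 'rV[R]_q -> R)
    (x : nat -> 'rV[R]_q) :
  continuous f -> continuous g -> (forall y, 0 < f y < 1) -> (forall y, 0 < g y < 1) ->
  (exists r : R, forall k, `|x k| <= r) ->
  exists2 D : R, 0 <= D & forall k, `|ln (f (x k) / g (x k))| <= D.
Proof.
move=> cf cg f01 g01 xr.
have aux (h : 'rV[R]_q -> R) : continuous h -> (forall y, 0 < h y < 1) ->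
    exists2 D : R, 0 <= D & forall k, - D <= ln (h (x k)) <= 0.
  move=> ch h01.
  have h0 y : 0 < h y by have /andP[] := h01 y.
  have h1 y : h y <= 1 by have /andP[_ /ltW] := h01 y.
  have [e e0 he] := bounded_seq_continuous_pos _ _ _ _ ch h0 xr.
  have e1 : e <= 1 := le_trans (he 0%N) (h1 _).
  exists (- ln e) => [|k]; first by rewrite oppr_ge0 ln_le0.
  by rewrite opprK ler_ln ?posrE// he/= ln_le0.
have [D1 D10 fD] := aux _ cf f01; have [D2 D20 gD] := aux _ cg g01.
exists (D1 + D2) => [|k]; first exact: addr_ge0.
have /andP[f0 _] := f01 (x k); have /andP[g0 _] := g01 (x k).
rewrite ln_div ?posrE// ler_norml.
by have /andP[? ?] := fD k; have /andP[? ?] := gD k; lra.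
Qed.

Theorem theorem2 (R : realType) (q M : nat)
  (S : set 'rV[R]_q) (ell : 'rV[R]_q -> 'rV[R]_q -> R)
  (d : measure_display) (T : measurableType d) (P : probability T R)
  (s : 'rV[R]_q) (xi : nat -> 'rV[R]_q) (dd : nat -> {RV P >-> R})
  (c : 'I_M -> 'rV[R]_q) (p0 : 'I_M -> R) :
  compact S ->
  (forall x y, 0 < ell x y < 1) ->
  continuous (fun z : 'rV[R]_q * 'rV[R]_q => ell z.1 z.2) ->
  S s ->
  (exists r : R, forall k, `|xi k| <= r) ->
  (forall k, (0 < k)%N -> forall w, dd k w = 0 \/ dd k w = 1) ->
  (forall k, (0 < k)%N -> P (dd k @^-1` [set 1]) = (ell s (xi k))%:E) ->
  mutually_independent_RVs P [set k | (0 < k)%N] (fun k => dd k : T -> R) ->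
  injective c ->
  (forall i, S (c i)) ->
  (forall i, 0 < p0 i < 1) ->
  \sum_(i < M) p0 i = 1 ->
  forall i : 'I_M,
  (exists (j : 'I_M) (p : R), 1 / 2 < p /\
     (limn_esup (fun n : nat =>
        ((n%:R `^ p)^-1 * \sum_(1 <= k < n.+1) mu ell s c xi i j k)%:E)
      < 0)%E) ->
  {ae P, forall w, (fun k => phat ell c p0 xi (fun k => dd k w) k i) @ \oo --> 0}.
Proof.
move=> _ ell01 cell _ xir dd01 Pdd idd _ _ p01 _ i [j [p [p12]]].
move=> /limn_esup_lt0_near[e e0 [N1 _ muN]].
have cell1 x : continuous (ell x).
  move=> y; apply: (@continuous2_cvg _ _ _ _ (nbhs y) _ (cst x) id ell x y (cell (x, y))).
  - exact: cvg_cst.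
  - exact: cvg_id.
have cell2 x : continuous (fun y => 1 - ell x y).
  by move=> y; apply: continuousB; [exact: cst_continuous|exact: cell1].
have ell01' x y : 0 < 1 - ell x y < 1.
  by have /andP[? ?] := ell01 x y; apply/andP; split; lra.
pose a k := ln (ell (c i) (xi k) / ell (c j) (xi k)).
pose b k := ln ((1 - ell (c i) (xi k)) / (1 - ell (c j) (xi k))).
have [D1 D10 aD] :=
  ln_ratio_bounded _ _ _ _ _ (cell1 (c i)) (cell1 (c j)) (ell01 _) (ell01 _) xir.
have [D2 D20 bD] :=
  ln_ratio_bounded _ _ _ _ _ (cell2 (c i)) (cell2 (c j)) (ell01' _) (ell01' _) xir.
(* The added 1 makes [D] strictly positive, as [D1] and [D2] may vanish. *)
pose D := D1 + D2 + 1.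
have D0 : 0 < D by rewrite /D; lra.
have abD k : (0 < k)%N -> `|a k - b k| <= D.
  move=> _; apply: le_trans (ler_normB _ _) _.
  by have := aD k; have := bD k; rewrite -/(a k) -/(b k) /D; lra.
pose W n w := \sum_(1 <= k < n.+1) (b k + (a k - b k) * dd k w).
(* The bad event: fluctuations consume at least half of the drift [- e * n ^ p]. *)
pose A n := [set w | - (e / 2 * n%:R `^ p) <= W n w].
pose N := N1.+1.
(* The rate in the deviation bound at [t = e / 2 * n ^ p], once [sqrt n] is absorbed into the power
   of [n]. *)
pose kap := e / 2 / (3 * D).
have kap0 : 0 < kap by rewrite !divr_gt0// mulr_gt0.
have PA n : (N <= n)%N ->
    (P (A n) <= (expR 1 * expR (- (kap * n%:R `^ (p - 2^-1))))%:E)%E.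
  move=> Nn; have n0 : (0 < n)%N by exact: leq_trans Nn.
  have nn0 : 0 < n%:R :> R by rewrite ltr0n.
  have expE : 1 - e / 2 * n%:R `^ p / (3 * D * Num.sqrt n%:R) =
      1 + - (kap * n%:R `^ (p - 2^-1)).
    rewrite powRB; last by rewrite pnatr_eq0 -lt0n n0 implybT.
    rewrite powR12_sqrt ?ltW// /kap.
    by field; rewrite !gt_eqF ?sqrtr_gt0.
  rewrite -expRD -expE.
  have := bernoulli_sum_deviation _ _ _ _ _ _ a b D (e / 2 * n%:R `^ p) n
    dd01 Pdd idd D0 abD n0.
  (* The centring term [l k * a k + (1 - l k) * b k] is [mu] itself. *)
  rewrite [X in (P X <= _)%E -> _](_ : _ = [set w | e / 2 * n%:R `^ p +
      \sum_(1 <= k < n.+1) mu ell s c xi i j k <= W n w]); last first.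
    by apply/seteqP; split => w /=; rewrite sumrB lerBrDr.
  apply: le_trans; apply: le_measure; rewrite ?inE;
    [exact: measurable_affine_sum_ge|exact: measurable_affine_sum_ge|].
  (* Since the sum of the [mu] is at most [- e * n ^ p], adding [e / 2 * n ^ p] stays below the
     threshold of [A n]. *)
  move=> w; apply: le_trans.
  have := muN n (ltnW Nn); rewrite /= ler_pdivrMl ?powR_gt0//.
  lra.
have p0' : 0 < p - 2^-1 by lra.
have [C C0 hC] := expR_stretched_le _ _ _ kap0 p0'.
have e20 : 0 < e / 2 by rewrite divr_gt0.
have p0'' : 0 < p by lra.
(* This second use, with exponent [p], bounds the posterior itself by a multiple of [1 / n]. *)
have [C' C'0 hC'] := expR_stretched_le _ _ _ e20 p0''.
have : (\sum_(n <oo) P (A (N + n)%N) < +oo)%E.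
  apply: (nneseries_telescope_lty _ _ (expR 1 * C) N) => //.
    by rewrite mulr_gt0 ?expR_gt0.
  move=> n; apply: le_trans (PA _ (leq_addr _ _)) _.
  by rewrite lee_fin -mulrA ler_pM2l ?expR_gt0// hC.
move=> /ae_eventually_notin -/(_ (fun n => measurable_affine_sum_ge _ _ _ _ _ _ _ _ _)).
apply: filterS => w [n1 _ hw].
apply: (@squeeze_cvgr _ _ _ _ (cst 0) (fun k => p0 i / p0 j * C' * k%:R^-1)).
- exists (N + n1)%N => // n /= Nn.
  rewrite ltW ?phat_gt0//=.
  apply: le_trans (phat_le_expR _ _ _ _ _ _ _ _ ell01 p01 n i j) _.
  rewrite -[leRHS]mulrA ler_pM2l; last first.
    by have /andP[? _] := p01 i; have /andP[? _] := p01 j; rewrite divr_gt0.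
  have n0 : (0 < n)%N by apply: leq_trans Nn.
  apply: (@le_trans _ _ (expR (- (e / 2 * n%:R `^ p)))).
    rewrite ler_expR ltW// ltNge; apply/negP.
    have -> : \sum_(1 <= m < n.+1) (ln (gobs ell (dd m w) (c i) (xi m)) -
       ln (gobs ell (dd m w) (c j) (xi m))) = W n w.
      rewrite /W !big_nat; apply: eq_bigr => m /andP[m0 _].
      by rewrite ln_gobs_ratio//; exact: dd01.
    (* [hw] concerns the events shifted by [N], hence the index [n - N], which is at least [n1]. *)
    have := hw (n - N)%N; rewrite /= subnKC; last exact: leq_trans (leq_addr _ _) Nn.
    by apply; rewrite leq_subRL// (leq_trans (leq_addr _ _) Nn).
  apply: le_trans (hC' _ n0) _.
  by rewrite ler_pM2l// gerBl invr_ge0.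
- exact: cvg_cst.
- rewrite -[X in _ --> X](mulr0 (p0 i / p0 j * C')); apply: cvgMr.
  (* The harmonic sequence is [1 / (k + 1)], hence the shift by one. *)
  rewrite -(cvg_shiftS (fun k : nat => k%:R^-1 : R)); exact: cvg_harmonic.
Qed.
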